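(* Let $K$ be a perfect field, $d\ge 2$, let $V_1,\dots,V_d,W_1,\dots,W_d$ be finite-dimensional $K$-vector spaces, and let $\alpha\in\mathbb{R}^d_{>0}$. For all $v\in V_1\otimes\cdots\otimes V_d$ and $w\in W_1\otimes\cdots\otimes W_d$ we have $$\operatorname{rk}^G_\alpha(v\boxplus w)=\operatorname{rk}^G_\alpha(v)+\operatorname{rk}^G_\alpha(w).$$
   Context: Vertical direct sum: $v\boxplus w$ denotes the element $(v,w)$ of $(V_1\otimes\cdots\otimes V_d)\oplus(W_1\otimes\cdots\otimes W_d)$, viewed inside $(V_1\oplus W_1)\otimes(V_2\oplus W_2)\otimes\cdots\otimes(V_d\oplus W_d)$, i.e. the sum of the images of $v$ and $w$ under the maps induced by the inclusions $V_i\hookrightarrow V_i\oplus W_i$ and $W_i\hookrightarrow V_i\oplus W_i$. $G$-stable rank of a tensor $u\in U=U_1\otimes\cdots\otimes U_d$ ($U_i$ finite-dimensional over $K$): for a $K$-vector space $W$ and $v(t)\in K((t))\otimes W$, $\operatorname{val}_t(v(t))$ is the largest integer $m$ with $v(t)\in t^m(K[[t]]\otimes W)$, and $\operatorname{val}_t(0)=\infty$. Let $\mathrm{GL}(U_i,K[[t]])$ be the set of elements of $K[[t]]\otimes\operatorname{End}(U_i)$ that are invertible over $K((t))$ (the inverse need not have entries in $K[[t]]$), and $G(K[[t]])=\prod_i\mathrm{GL}(U_i,K[[t]])$, acting on $K((t))\otimes U$ factorwise. Then $\operatorname{rk}^G_\alpha(u)$ is the infimum of $$\mu_\alpha(g(t),u)=\frac{\sum_{i=1}^d\alpha_i\operatorname{val}_t(\det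 g_i(t))}{\operatorname{val}_t(g(t)\cdot u)}$$ over all $g(t)=(g_1(t),\dots,g_d(t))\in G(K[[t]])$ with $\operatorname{val}_t(g(t)\cdot u)>0$ (a quotient with denominator $\infty$ is $0$). *)

(* Defs.v *)
From HB Require Import structures.
From mathcomp Require Import all_boot all_order all_algebra all_field.
From mathcomp Require Import all_classical all_reals ereal.

Set Implicit Arguments.
Unset Strict Implicit.
Unset Printing Implicit Defensive.

Import Order.TTheory GRing.Theory Num.Theory VectorInternalTheory.

Local Open Scope ring_scope.

Definition perfect_field (K : fieldType) : Prop :=
  forall p : {poly K}, irreducible_poly p -> separable_poly p.

Record pseries (K : fieldType) := PSeries { pcoef : nat -> K }.

HB.instance Definition _ (K : fieldType) := gen_eqMixin (pseries K).
HB.instance Definition _ (K : fieldType) := gen_choiceMixin (pseries K).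

Section PowerSeries.
Variable K : fieldType.
Implicit Types f g h : pseries K.

Lemma pseriesP f g : (forall n, pcoef f n = pcoef g n) -> f = g.
Proof. by case: f g => [f] [g] /= /funext ->. Qed.

Definition psC (c : K) : pseries K := PSeries (fun n => if n == 0%N then c else 0).
Definition psX : pseries K := PSeries (fun n => (n == 1%N)%:R).
Definition psadd f g := PSeries (fun n => pcoef f n + pcoef g n).
Definition psopp f := PSeries (fun n => - pcoef f n).
Definition psmul f g :=
  PSeries (fun n => \sum_(i < n.+1) pcoef f i * pcoef g (n - i)%N).

Fact psaddA : associative psadd.
Proof. by move=> f g h; apply: pseriesP => n /=; rewrite addrA. Qed.
Fact psaddC : commutative psadd.
Proof. by move=> f g; apply: pseriesP => n /=; rewrite addrC. Qed.
Fact psadd0 : left_id (psC 0) psadd.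
Proof. by move=> f; apply: pseriesP => n /=; rewrite if_same add0r. Qed.
Fact psaddN : left_inverse (psC 0) psopp psadd.
Proof. by move=> f; apply: pseriesP => n /=; rewrite if_same addNr. Qed.

HB.instance Definition _ :=
  GRing.isZmodule.Build (pseries K) psaddA psaddC psadd0 psaddN.

Definition pstrunc n f : {poly K} := \poly_(i < n) pcoef f i.

Fact pcoef_mul_trunc f g n k : (k < n)%N ->
  pcoef (psmul f g) k = (pstrunc n f * pstrunc n g)`_k.
Proof.
move=> kn; rewrite coefM /=; apply: eq_bigr => i _.
by rewrite !coef_poly !(leq_ltn_trans _ kn) ?leq_subr // -ltnS.
Qed.

Fact psmulC : commutative psmul.
Proof.
by move=> f g; apply: pseriesP => n; rewrite !(@pcoef_mul_trunc _ _ n.+1) // mulrC.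
Qed.

Fact psmulA : associative psmul.
Proof.
move=> f g h; apply: pseriesP => n.
have -> : pcoef (psmul f (psmul g h)) n =
    (pstrunc n.+1 f * (pstrunc n.+1 g * pstrunc n.+1 h))`_n.
  rewrite coefM; apply: eq_bigr => i _; rewrite (@pcoef_mul_trunc _ _ n.+1).
    by rewrite coef_poly ltn_ord.
  by rewrite ltnS leq_subr.
rewrite mulrA coefM; apply: eq_bigr => i _.
by rewrite (@pcoef_mul_trunc _ _ n.+1) // coef_poly ltnS leq_subr.
Qed.

Fact psmul1 : left_id (psC 1) psmul.
Proof.
move=> f; apply: pseriesP => n /=.
rewrite big_ord_recl /= subn0 mul1r big1 ?addr0 // => i _.
by rewrite mul0r.
Qed.

Fact psmulDl : left_distributive psmul psadd.
Proof.
move=> f g h; apply: pseriesP => n /=; rewrite -big_split.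
by apply: eq_bigr => i _; rewrite mulrDl.
Qed.

Fact ps1_neq0 : psC 1 != psC 0.
Proof.
by apply/eqP => /(congr1 (fun f => pcoef f 0)) /= /eqP; rewrite oner_eq0.
Qed.

HB.instance Definition _ := GRing.Zmodule_isComNzRing.Build (pseries K)
  psmulA psmulC psmul1 psmulDl ps1_neq0.

(** Only the existence of inverses matters here, so they are chosen classically. *)
Definition psunit f := `[< exists g, g * f = 1 >].
Definition psinv f := xget f [set g | g * f = 1].

Fact psmulVx : {in psunit, left_inverse 1 psinv *%R}.
Proof.
move=> f /asboolP [g gf1]; rewrite /psinv.
by case: xgetP => [h _ //|/(_ g)]; case.
Qed.
Fact psunitPl f g : g * f = 1 -> psunit f.
Proof. by move=> gf1; apply/asboolP; exists g. Qed.
Fact psinv_out : {in [predC psunit], psinv =1 id}.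
Proof.
move=> f /asboolP nf; rewrite /psinv; case: xgetP => // g _ gf1.
by case: nf; exists g.
Qed.

HB.instance Definition _ := GRing.ComNzRing_hasMulInverse.Build (pseries K)
  psmulVx psunitPl psinv_out.

Fact ps_order f : f != 0 ->
  exists2 n, pcoef f n != 0 & forall m, (m < n)%N -> pcoef f m = 0.
Proof.
move=> f0; have [n fn] : exists n, pcoef f n != 0.
  apply: contrapT => nf; case/eqP: f0; apply: pseriesP => n /=.
  by rewrite if_same; apply: contrapT => /eqP fn; apply: nf; exists n.
have exn : exists n, pcoef f n != 0 by exists n.
exists (ex_minn exn); case: ex_minnP => // m _ minm k km.
by apply/eqP; apply: contraTT km => /minm; rewrite -leqNgt.
Qed.

Fact ps_integral : GRing.integral_domain_axiom (pseries K).
Proof.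
move=> f g fg0; apply/norP => -[/ps_order[i fi ltf] /ps_order[j gj ltg]].
move/(congr1 (fun h => pcoef h (i + j))): fg0 => /=.
have iij : (i < (i + j).+1)%N by rewrite ltnS leq_addr.
rewrite (bigD1 (Ordinal iij)) //= addKn big1 ?addr0 => [|k ki].
  by rewrite if_same => /eqP; rewrite mulf_eq0 (negPf fi) (negPf gj).
case: (ltngtP k i) => [/ltf -> | ik | ek]; rewrite ?mul0r //.
  rewrite ltg ?mulr0 // ltn_subLR ?ltn_add2r //; last by rewrite -ltnS ltn_ord.
by case/eqP: ki; apply: val_inj.
Qed.

HB.instance Definition _ :=
  GRing.ComUnitRing_isIntegral.Build (pseries K) ps_integral.

End PowerSeries.

(** [K((t))] is the fraction field of [K[[t]]]. *)
Notation laurent K := {fraction (pseries K)}.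

Definition tvar (K : fieldType) : laurent K := tofrac (psX K).

(** [val_t x] for [x] in [K((t)) ⊗ W], where [x] is given by its coordinates in a
    basis of [W] indexed by [I]. The supremum is over all integers [m] with
    [x] in [t^m (K[[t]] ⊗ W)]; for [x = 0] this is every integer, so that the
    value is [+oo], as required. *)
Definition valt (R : realType) (K : fieldType) (I : finType)
    (x : I -> laurent K) : \bar R :=
  ereal_sup [set (m%:~R)%:E | m in
    [set m : int | forall i, exists p : pseries K, x i = tvar K ^ m * tofrac p]].

Definition valt_scalar (R : realType) (K : fieldType) (a : laurent K) : \bar R :=
  valt R (fun _ : unit => a).

Section Tensors.
Variable d : nat.

(** [A ⊗ U_1 ⊗ ... ⊗ U_d] for free modules [U_i] with a basis indexed by ['I_(n i)]. *)
Definition tensor (A : Type) (n : 'I_d -> nat) : Type :=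
  {ffun {dffun forall i : 'I_d, 'I_(n i)} -> A}.

(** The map induced on tensors by the linear maps of matrices [g i]; as everywhere
    in MathComp, matrices act on row vectors from the right. *)
Definition tensor_mul (A : comPzRingType) (m n : 'I_d -> nat)
    (g : forall i, 'M[A]_(m i, n i)) (x : tensor A m) : tensor A n :=
  [ffun J : {dffun forall i : 'I_d, 'I_(n i)} =>
     \sum_(I : {dffun forall i : 'I_d, 'I_(m i)})
        x I * \prod_(i < d) g i (I i) (J i)].

Section Spaces.
Variable K : fieldType.
Implicit Types U V W : 'I_d -> vectType K.

(** [V_1 ⊗ ... ⊗ V_d], in the coordinates [v2r] that come with each [V_i]; see
    [tpure_span] and [tprod_map_pure] below for the link with pure tensors. *)
Definition tprod V : Type := tensor K (fun i => dim (V i)).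

Definition tpure V (x : forall i, V i) : tprod V :=
  [ffun J : {dffun forall i, 'I_(dim (V i))} => \prod_(i < d) v2r (x i) 0 (J i)].

Definition tprod_map V W (f : forall i, 'Hom(V i, W i)) : tprod V -> tprod W :=
  tensor_mul (fun i => f2mx (f i)).

Definition dsum V W : 'I_d -> vectType K := fun i => (V i * W i)%type.

Definition incl1 V W i : 'Hom(V i, dsum V W i) := linfun (fun x : V i => (x, 0)).
Definition incl2 V W i : 'Hom(W i, dsum V W i) := linfun (fun x : W i => (0, x)).

Definition vdsum V W (v : tprod V) (w : tprod W) : tprod (dsum V W) :=
  tprod_map (incl1 V W) v + tprod_map (incl2 V W) w.

Lemma bigA_distr_dffun (T : 'I_d -> finType) (P : forall i, T i -> K) :
  \prod_(i < d) \sum_(j : T i) P i j =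
  \sum_(f : {dffun forall i, T i}) \prod_(i < d) P i (f i).
Proof.
rewrite (reindex (@dffun_of_fprod _ T)) /=; last exact/onW_bij/dffun_of_fprod_bij.
pose Q i := [ffun j => P i j].
transitivity (\sum_(t : fprod T) \prod_(i < d) Q i (t i)).
  rewrite big_fprod -(bigA_distr_big_dep _ (fun i => untag 0 (Q i))).
  apply: eq_bigr => i _.
  by rewrite -(big_tag (fun i => Q i : T i -> K)); apply: eq_bigr => j _; rewrite ffunE.
by apply: eq_bigr => t _; apply: eq_bigr => i _; rewrite !ffunE.
Qed.

Lemma tpure_span V (x : tprod V) :
  x = \sum_(I : {dffun forall i, 'I_(dim (V i))})
        [ffun J => x I * tpure (fun i => r2v (delta_mx 0 (I i)) : V i) J].
Proof.
apply/ffunP => J; rewrite sum_ffunE (bigD1 J) //= big1 => [|I IJ].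
  by rewrite !ffunE big1 ?mulr1 ?addr0 // => i _; rewrite r2vK mxE !eqxx.
rewrite !ffunE; have [i Ji] : exists i, J i != I i.
  apply/existsP; apply: contraR IJ => /existsPn IJ; apply/eqP/ffunP => i.
  by apply/esym/eqP; move: (IJ i); rewrite negbK.
by rewrite (bigD1 i) //= r2vK mxE (negPf Ji) andbF mul0r mulr0.
Qed.

Lemma tprod_map_pure V W (f : forall i, 'Hom(V i, W i)) (x : forall i, V i) :
  tprod_map f (tpure x) = tpure (fun i => f i (x i)).
Proof.
apply/ffunP => J; rewrite !ffunE.
under [RHS]eq_bigr => i _ do rewrite unlock /= r2vK mxE.
rewrite bigA_distr_dffun; apply: eq_bigr => I _.
by rewrite ffunE big_split.
Qed.

Lemma incl1E V W i (x : V i) : incl1 V W i x = (x, 0).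
Proof.
have l : linear (fun x : V i => (x, 0) : V i * W i).
  by move=> a y z; apply: injective_projections; rewrite //= scaler0 addr0.
pose f : {linear V i -> (V i * W i)%type} :=
  HB.pack (fun x : V i => (x, 0) : V i * W i) (GRing.isLinear.Build _ _ _ _ _ l).
exact: (lfunE f).
Qed.

Lemma incl2E V W i (x : W i) : incl2 V W i x = (0, x).
Proof.
have l : linear (fun x : W i => (0, x) : V i * W i).
  by move=> a y z; apply: injective_projections; rewrite //= scaler0 addr0.
pose f : {linear W i -> (V i * W i)%type} :=
  HB.pack (fun x : W i => (0, x) : V i * W i) (GRing.isLinear.Build _ _ _ _ _ l).
exact: (lfunE f).
Qed.

Section StableRank.
Variable U : 'I_d -> vectType K.

(** [K[[t]] ⊗ End(U_i)] is identified with matrices over [K[[t]]]. *)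
Definition endo_tuple := forall i, 'M[pseries K]_(dim (U i)).

Definition to_laurent (g : endo_tuple) i : 'M[laurent K]_(dim (U i)) :=
  map_mx (@tofrac (pseries K)) (g i).

Definition GLpseries (g : endo_tuple) : Prop :=
  forall i, to_laurent g i \in unitmx.

Definition tensor_laurent (u : tprod U) : tensor (laurent K) (fun i => dim (U i)) :=
  [ffun I => tofrac (psC (u I))].

Definition act (g : endo_tuple) (u : tprod U) :
    tensor (laurent K) (fun i => dim (U i)) :=
  tensor_mul (to_laurent g) (tensor_laurent u).

Variables (R : realType) (alpha : 'I_d -> R).

Local Open Scope ereal_scope.

(** In [\bar R], division by [+oo] gives [0]. *)
Definition mu (g : endo_tuple) (u : tprod U) : \bar R :=
  (\sum_(i < d) (alpha i)%:E * valt_scalar R (\det (to_laurent g i))%R)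
    / valt R (act g u).

Definition Gstable_rank (u : tprod U) : \bar R :=
  ereal_inf [set mu g u | g in
    [set g | GLpseries g /\ 0 < valt R (act g u)]%classic]%classic.

End StableRank.
End Spaces.
End Tensors.

(* Main.v *)
From HB Require Import structures.
Require Import Defs.
From mathcomp Require Import all_boot all_order all_algebra.
From mathcomp Require Import fingroup perm.
From mathcomp Require Import all_classical all_reals ereal.

(** The G-stable rank of [u] is the infimum of the quotients [D / s], where
    [g] is a tuple of matrices over [K[[t]]] with nonzero determinants,
    [D = \sum_i alpha_i val_t (det g_i)], and [s > 0] is any integer such that
    [t ^ s] divides [g . u]. The theorem holds because the set of these quotients
    for [v [+] w] is exactly the Minkowski sum of the sets for [v] and for [w]
    ([stable_quotients_dsum_add] and [stable_quotients_dsum_split]); infima of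
    nonempty sets bounded below add up under Minkowski sums.

    Two quotients [D / s] and [E / r], for [(g, s)] and [(h, r)], are added as
    follows. Substituting [t ^ r] for [t] in [g] multiplies both [D] and [s] by
    [r], and likewise [t ^ s] in [h]; both tensors are then divisible by
    [t ^ (r * s)]. The block diagonal tuple made of the two substituted ones sends
    [v [+] w] to a multiple of [t ^ (r * s)], and its quotient is
    [(r D + s E) / (r s) = D / s + E / r].

    Conversely, let [g] act on the sum of the two spaces in each factor, with
    [t ^ s] dividing [g . (v [+] w)]. Multiplying each [g_i] by a matrix invertible
    over [K[[t]]] changes neither the divisibility nor the valuations of the
    determinants, and, [K[[t]]] being a valuation ring, it brings [g_i] to block
    triangular form with diagonal blocks [a_i] and [b_i]. The direction of the
    triangle can be chosen in each factor: take one factor block lower triangular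
    and all the others block upper triangular. Since [d >= 2], both shapes occur.
    With row vectors, the lower shape keeps [V_i] in itself and the upper shape
    keeps [W_i] in itself. Hence [w] does not contribute to the component in the
    tensor product of the [V_i], because some [W_i] is kept in itself, and this
    component is [a . v]; symmetrically the component in the tensor product of the
    [W_i] is [b . w]. Both are therefore divisible by [t ^ s], and
    [det a_i * det b_i] has the valuation of [det g_i], so that the quotient splits
    as the sum of one for [v] and one for [w]. *)

Set Implicit Arguments.
Unset Strict Implicit.
Unset Printing Implicit Defensive.

Import Order.TTheory GRing.Theory Num.Theory VectorInternalTheory.

Local Open Scope ring_scope.

(** * Orders of vanishing of power series *)

Section PowerSeriesOrder.
Variable K : fieldType.
Implicit Types f g h u : pseries K.

Lemma pcoefD f g n : pcoef (f + g) n = pcoef f n + pcoef g n.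
Proof. by []. Qed.

Lemma pcoef_sum (I : Type) (r : seq I) (P : pred I) (F : I -> pseries K) n :
  pcoef (\sum_(i <- r | P i) F i) n = \sum_(i <- r | P i) pcoef (F i) n.
Proof.
apply: (big_morph (fun f => pcoef f n)) => //=.
by rewrite if_same.
Qed.

Lemma pcoefM f g n : pcoef (f * g) n = \sum_(i < n.+1) pcoef f i * pcoef g (n - i)%N.
Proof. by []. Qed.

Lemma pcoef1 n : pcoef (1 : pseries K) n = (n == 0%N)%:R.
Proof. by rewrite /=; case: eqP. Qed.

Lemma pcoefXM f n : pcoef (psX K * f) n = if n is m.+1 then pcoef f m else 0.
Proof.
rewrite pcoefM; case: n => [|n].
  by rewrite big_ord_recl big_ord0 /= mul0r addr0.
rewrite 2!big_ord_recl /= mul0r add0r mul1r subSS subn0.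
by rewrite big1 ?addr0 // => i _; rewrite mul0r.
Qed.

Lemma pcoefXnM n f m :
  pcoef (psX K ^+ n * f) m = if (m < n)%N then 0 else pcoef f (m - n).
Proof.
elim: n m => [|n IHn] m; first by rewrite expr0 mul1r subn0.
by rewrite exprS -mulrA pcoefXM; case: m => [|m].
Qed.

Lemma psX_factor n f : (forall k, (k < n)%N -> pcoef f k = 0) ->
  f = psX K ^+ n * PSeries (fun m => pcoef f (m + n)).
Proof.
move=> fn; apply: pseriesP => m; rewrite pcoefXnM.
by case: ltnP => [/fn //|nm] /=; rewrite subnK.
Qed.

(** The inverse of [c (1 - h)] with [h] divisible by [t] is a geometric series;
    its coefficient of index [n] only involves the powers [h ^ k] with [k <= n]. *)
Lemma psunitE f : pcoef f 0 != 0 -> f \is a GRing.unit.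
Proof.
move=> f0; set c := pcoef f 0 in f0.
pose h := 1 - psC c^-1 * f.
have fE : psC c^-1 * f = 1 - h by rewrite /h opprB addrC subrK.
have h0 : pcoef h 0 = 0.
  by rewrite /= big_ord_recl big_ord0 /= addr0 mulVf // subrr.
have hX : h = psX K ^+ 1 * PSeries (fun m => pcoef h (m + 1)).
  by apply: psX_factor => -[|k].
have hk k n : (n < k)%N -> pcoef (h ^+ k) n = 0.
  by move=> nk; rewrite hX exprMn expr1 pcoefXnM nk.
pose G n := \sum_(k < n) h ^+ k.
have GE m n : (n < m)%N -> pcoef (G m) n = pcoef (G n.+1) n.
  move=> nm; rewrite !pcoef_sum -(subnKC nm) big_split_ord /=.
  rewrite [X in _ + X]big1 ?addr0 // => i _; apply: hk.
  by rewrite leq_addr.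
pose g := PSeries (fun n => pcoef (G n.+1) n).
have hg : (1 - h) * g = 1.
  apply: pseriesP => n.
  transitivity (pcoef ((1 - h) * G n.+1) n).
    rewrite !pcoefM; apply: eq_bigr => i _ /=; congr (_ * _).
    by rewrite [RHS]GE // ltnS leq_subr.
  rewrite -opprB mulNr -subrX1 opprB pcoefD.
  by rewrite -[RHS]addr0; congr (_ + _); rewrite /= hk ?oppr0.
apply/unitrP; exists (psC c^-1 * g); split.
  by rewrite mulrAC fE.
by rewrite mulrA [f * _]mulrC fE.
Qed.

Lemma psC_unit (c : K) : c != 0 -> psC c \is a GRing.unit.
Proof. by move=> c0; apply: psunitE. Qed.

Fact psC_zmod_morphism : zmod_morphism (@psC K).
Proof. by move=> a b; apply: pseriesP => -[|n] //=; rewrite subr0. Qed.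
HB.instance Definition _ := GRing.isZmodMorphism.Build K (pseries K) (@psC K)
  psC_zmod_morphism.

Fact psC_monoid_morphism : monoid_morphism (@psC K).
Proof.
split=> // a b; apply: pseriesP => n; rewrite pcoefM big_ord_recl subn0.
rewrite big1 ?addr0 => [|i _]; last by rewrite mul0r.
by case: n => [|n] //=; rewrite mulr0.
Qed.
HB.instance Definition _ := GRing.isMonoidMorphism.Build K (pseries K) (@psC K)
  psC_monoid_morphism.

(** [t ^ n] times a unit: the form in which orders of vanishing add up under
    products and are scaled by substitutions. *)
Definition has_order f n := exists2 u, u \is a GRing.unit & f = psX K ^+ n * u.

Lemma psX_neq0 : psX K != 0.
Proof. by apply/eqP => /(congr1 (fun f => pcoef f 1)) /= /eqP; rewrite oner_eq0. Qed.

Lemma has_order_coef f n : has_order f n ->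
  pcoef f n != 0 /\ forall k, (k < n)%N -> pcoef f k = 0.
Proof.
case=> u uu ->; split=> [|k kn]; rewrite pcoefXnM ?kn // ltnn subnn.
apply/eqP => u0; have /(congr1 (fun f => pcoef f 0)) := divrr uu.
by rewrite pcoefM big_ord1 u0 mul0r => /esym/eqP /=; rewrite oner_eq0.
Qed.

Lemma has_order_exists f : f != 0 -> exists n, has_order f n.
Proof.
move=> /ps_order[n fn ltn]; exists n; eexists; last exact: psX_factor.
exact: psunitE.
Qed.

Lemma has_order_neq0 f n : has_order f n -> f != 0.
Proof.
move=> /has_order_coef[fn _]; apply: contraNneq fn => ->.
by rewrite /= if_same.
Qed.

Lemma has_order_uniq f m n : has_order f m -> has_order f n -> m = n.
Proof.
move=> /has_order_coef[fm ltm] /has_order_coef[fn ltn].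
case: (ltngtP m n) => // [/ltn|/ltm] /eqP; first by rewrite (negPf fm).
by rewrite (negPf fn).
Qed.

Lemma has_orderM f g m n :
  has_order f m -> has_order g n -> has_order (f * g) (m + n).
Proof.
move=> [u uu ->] [v vu ->]; exists (u * v); first by rewrite unitrM uu.
by rewrite exprD mulrACA.
Qed.

Lemma has_order_unit u : u \is a GRing.unit -> has_order u 0.
Proof. by exists u; rewrite // expr0 mul1r. Qed.

Lemma ps_unit_neq0 u : u \is a GRing.unit -> u != 0.
Proof. by move=> /has_order_unit/has_order_neq0. Qed.

(** The [t]-adic valuation, with the default value 0 at the zero series; it is
    only meaningful on nonzero series. *)
Definition psord f : nat := xget 0%N (has_order f).

Lemma psordP f : f != 0 -> has_order f (psord f).
Proof.
move=> /has_order_exists[n fn]; rewrite /psord.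
by case: xgetP => // /(_ n).
Qed.

Lemma psord_eq f n : has_order f n -> psord f = n.
Proof.
by move=> fn; apply: (has_order_uniq _ fn); apply: psordP; apply: has_order_neq0 fn.
Qed.

Lemma psordM f g : f != 0 -> g != 0 -> psord (f * g) = (psord f + psord g)%N.
Proof. by move=> f0 g0; apply: psord_eq; apply: has_orderM; apply: psordP. Qed.

Lemma psord_unit u : u \is a GRing.unit -> psord u = 0%N.
Proof. by move=> uu; apply/psord_eq/has_order_unit. Qed.

(** [K[[t]]] is a valuation ring, which is all that column reduction needs. *)
Lemma ps_dvd_total f g : (exists h, g = f * h) \/ (exists h, f = g * h).
Proof.
have [->|f0] := eqVneq f 0; first by right; exists 0; rewrite mulr0.
have [->|g0] := eqVneq g 0; first by left; exists 0; rewrite mulr0.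
have [[u uu fE] [v vu gE]] := (psordP f0, psordP g0).
case: (leqP (psord f) (psord g)) => [|/ltnW] le; [left|right].
  exists (psX K ^+ (psord g - psord f) * (u^-1 * v)).
  by rewrite {1}gE {1}fE mulrACA -exprD subnKC // mulVKr.
exists (psX K ^+ (psord f - psord g) * (v^-1 * u)).
by rewrite {1}gE {1}fE mulrACA -exprD subnKC // mulVKr.
Qed.

(** The substitution [t := t ^ k.+1]; the exponent is a successor because
    [t := t ^ 0] makes no sense for power series. *)
Definition pssubst (k : nat) f : pseries K :=
  PSeries (fun n => if (k.+1 %| n)%N then pcoef f (n %/ k.+1) else 0).

Fact pssubst_zmod_morphism k : zmod_morphism (pssubst k).
Proof. by move=> f g; apply: pseriesP => n /=; case: ifP; rewrite ?subr0. Qed.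
HB.instance Definition _ k :=
  GRing.isZmodMorphism.Build _ _ (pssubst k) (pssubst_zmod_morphism k).

Lemma pssubst_psC k c : pssubst k (psC c) = psC c.
Proof.
apply: pseriesP => n /=; have [->|n0] := eqVneq n 0%N; first by rewrite dvdn0 div0n.
case: ifP => // dvd; case: eqP => // e.
by rewrite -(divnK dvd) e in n0.
Qed.

(** Up to index [n], the substitution is the composition of polynomials with
    [X ^ k.+1], which is multiplicative. *)
Fact pssubst_monoid_morphism k : monoid_morphism (pssubst k).
Proof.
split=> [|f g]; first exact: pssubst_psC.
apply: pseriesP => n.
have cE h i : (i < n.+1)%N ->
    pcoef (pssubst k h) i = (pstrunc n.+1 h \Po 'X^(k.+1))`_i.
  move=> ltin; rewrite coef_comp_poly_Xn // coef_poly /=.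
  by rewrite (leq_ltn_trans (leq_div _ _) ltin).
have -> : pcoef (pssubst k (f * g)) n =
    ((pstrunc n.+1 f * pstrunc n.+1 g) \Po 'X^(k.+1))`_n.
  rewrite coef_comp_poly_Xn //= -(@pcoef_mul_trunc _ f g n.+1) //.
  by rewrite ltnS leq_div.
rewrite rmorphM coefM pcoefM.
apply: eq_bigr => i _; rewrite !cE //.
by rewrite ltnS leq_subr.
Qed.
HB.instance Definition _ k :=
  GRing.isMonoidMorphism.Build _ _ (pssubst k) (pssubst_monoid_morphism k).

Lemma pssubst_psX k : pssubst k (psX K) = psX K ^+ k.+1.
Proof.
apply: pseriesP => n; rewrite -[RHS]/(pcoef (psX K ^+ k.+1) n).
rewrite -[psX K ^+ _]mulr1 pcoefXnM pcoef1 /=; case: ltnP => [lt|le].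
  by case: ifP => // _; rewrite divn_small.
case: ifP => [dvd|ndvd].
  congr (nat_of_bool _)%:R; case/dvdnP: dvd le => q ->; rewrite mulnK //.
  by case: q => [|q] // _; rewrite mulSn addKn muln_eq0 orbF.
by case: eqP => // e; rewrite -(subnKC le) e addn0 dvdnn in ndvd.
Qed.

Lemma has_order_subst k f n : has_order f n -> has_order (pssubst k f) (k.+1 * n).
Proof.
case=> u uu ->; exists (pssubst k u); first exact: rmorph_unit.
by rewrite rmorphM rmorphXn /= pssubst_psX -exprM.
Qed.

Lemma psord_subst k f : f != 0 -> psord (pssubst k f) = (k.+1 * psord f)%N.
Proof. by move=> f0; apply/psord_eq/has_order_subst/psordP. Qed.

End PowerSeriesOrder.

(** * Column reduction over a valuation ring *)

Section ColumnReduction.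
Variable A : comUnitRingType.
Hypothesis dvd_total : forall x y : A, (exists z, y = x * z) \/ (exists z, x = y * z).

(** Divisibility is a total preorder, hence a finite family has a least element. *)
Lemma row_pivot n (r : 'rV[A]_n.+1) : exists j, forall i, exists z, r 0 i = r 0 j * z.
Proof.
elim: n r => [|n IHn] r; first by exists 0 => i; rewrite ord1; exists 1; rewrite mulr1.
have [j0 j0P] := IHn (\row_j r 0 (lift ord0 j)).
have dv i : exists z, r 0 (lift ord0 i) = r 0 (lift ord0 j0) * z.
  by have [z] := j0P i; rewrite !mxE => ->; exists z.
have [[z zE]|[z zE]] := dvd_total (r 0 ord0) (r 0 (lift ord0 j0)).
  exists ord0 => i; case: (unliftP ord0 i) => [j|] ->; last by exists 1; rewrite mulr1.
  by have [y ->] := dv j; exists (z * y); rewrite zE mulrA.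
exists (lift ord0 j0) => i; case: (unliftP ord0 i) => [j|] ->; first exact: dv.
by exists z.
Qed.

(** Move the pivot, which divides every entry, to the first column, and clear the
    other entries with it. *)
Lemma row_reduction n (r : 'rV[A]_(1 + n)) :
  exists2 k, k \in unitmx & rsubmx (r *m k) = 0.
Proof.
have [j jP] := row_pivot r.
have [r' r'def] : exists r' : 'rV_(1 + n), r' = r *m tperm_mx ord0 j by eexists.
have r'E i : r' 0 i = r 0 (tperm ord0 j i).
  by rewrite r'def /tperm_mx -(tpermV ord0 j) -col_permE mxE tpermV.
have [c cP] : exists c : 'rV[A]_n, rsubmx r' = lsubmx r' *m c.
  have /choice[c cP] : forall i : 'I_n, exists z, r' 0 (rshift 1 i) = r' 0 0 * z.
    move=> i; rewrite !r'E; have [z ->] := jP (tperm ord0 j (rshift 1 i)).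
    by exists z; rewrite tpermL.
  exists (\row_i c i); apply/rowP => i; rewrite !mxE big_ord1 !mxE cP.
  by congr (r' _ _ * _); apply: val_inj.
exists ((tperm_mx ord0 j : 'M_(1 + n)) *m block_mx 1%:M (- c) 0 1%:M).
  by rewrite unitmx_mul unitmx_perm unitmxE det_ublock !det1 mulr1 unitr1.
rewrite mulmxA -r'def -[r']hsubmxK mul_row_block row_mxKr mulmx1 mulmxN cP.
by rewrite addNr.
Qed.

(** Only the columns are changed, by a matrix invertible over the ring itself; this
    is the existence of a Hermite normal form, without its uniqueness. *)
Lemma lower_reduction m n (N : 'M[A]_(m, n)) : exists2 k, k \in unitmx &
  forall (i : 'I_m) (j : 'I_n), (i < j)%N -> (N *m k) i j = 0.
Proof.
elim: m n N => [|m IHm] [|n] N.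
- by exists 1%:M => [|[]]; rewrite ?unitmx1.
- by exists 1%:M => [|[]]; rewrite ?unitmx1.
- by exists 1%:M => [|? []]; rewrite ?unitmx1.
have [k1 k1u rk1] := @row_reduction n (usubmx (N : 'M_(1 + m, 1 + n))).
pose N1 : 'M_(1 + m, 1 + n) := (N : 'M_(1 + m, 1 + n)) *m k1.
have N1E : N1 = block_mx (ulsubmx N1) 0 (dlsubmx N1) (drsubmx N1).
  rewrite -{1}[N1]submxK; congr (block_mx _ _ _ _).
  rewrite -rk1 /ursubmx; congr rsubmx.
  by rewrite /N1 -[in LHS](vsubmxK (N : 'M_(1 + m, 1 + n))) mul_col_mx col_mxKu.
have [k2 k2u rk2] := IHm n (drsubmx N1).
exists (k1 *m (block_mx 1%:M 0 0 k2 : 'M_(1 + n))).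
  by rewrite unitmx_mul k1u unitmxE (@det_ublock _ 1 n) det1 mul1r -unitmxE.
have -> : N *m (k1 *m (block_mx 1%:M 0 0 k2 : 'M_(1 + n))) =
    block_mx (ulsubmx N1) 0 (dlsubmx N1) (drsubmx N1 *m k2).
  rewrite mulmxA -/N1 N1E (@mulmx_block _ 1 m 1 n 1 n).
  rewrite !block_mxKul !block_mxKdl !block_mxKdr.
  by rewrite !mulmx0 !mul0mx !mulmx1 !addr0 !add0r.
move=> i j; case: (@split_ordP 1 m i) => i' ->; case: (@split_ordP 1 n j) => j' ->.
- by rewrite !ord1.
- by rewrite (@block_mxEur _ 1 m 1 n) mxE.
- by rewrite ord1.
- by rewrite (@block_mxEdr _ 1 m 1 n) /= !add1n ltnS; apply: rk2.
Qed.

(** Reversing the order of the rows and of the columns exchanges the two triangular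
    shapes. *)
Lemma upper_reduction n (N : 'M[A]_n) : exists2 k, k \in unitmx &
  forall i j : 'I_n, (j < i)%N -> (N *m k) i j = 0.
Proof.
have rK := @rev_ordK n.
pose P : 'M[A]_n := perm_mx (perm (@rev_ord_inj n)).
have [k ku lk] := lower_reduction (P *m N *m P).
exists (P *m k *m P); first by rewrite !unitmx_mul ku unitmx_perm.
move=> i j lt.
have -> : (N *m (P *m k *m P)) i j = (P *m N *m P *m k) (rev_ord i) (rev_ord j).
  rewrite !mulmxA -(mulmxA P) -(mulmxA P) /P.
  rewrite -row_permE [RHS]mxE permE rK.
  set Q := _ *m k.
  have -> : perm_mx (perm (@rev_ord_inj n)) =
      perm_mx (perm (@rev_ord_inj n))^-1%g :> 'M[A]_n.
    congr perm_mx; apply/permP => x; apply: (@perm_inj _ (perm (@rev_ord_inj n))).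
    by rewrite permKV !permE rK.
  by rewrite -col_permE mxE permE.
by apply: lk; apply: ltn_sub2l => //; apply: leq_ltn_trans lt (ltn_ord i).
Qed.

Lemma block_lower_reduction n m (N : 'M[A]_(n + m)) : exists2 k, k \in unitmx &
  exists a c b, N *m k = block_mx a 0 c b :> 'M_(n + m).
Proof.
have [k ku lk] := lower_reduction N; exists k => //.
move: (N *m k) lk => M lk; exists (ulsubmx M), (dlsubmx M), (drsubmx M).
rewrite -[LHS]submxK; congr (block_mx _ _ _ _).
by apply/matrixP => i j; rewrite !mxE lk //= ltn_addr.
Qed.

Lemma block_upper_reduction n m (N : 'M[A]_(n + m)) : exists2 k, k \in unitmx &
  exists a c b, N *m k = block_mx a c 0 b :> 'M_(n + m).
Proof.
have [k ku lk] := upper_reduction N; exists k => //.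
move: (N *m k) lk => M lk; exists (ulsubmx M), (ursubmx M), (drsubmx M).
rewrite -[LHS]submxK; congr (block_mx _ _ _ _).
by apply/matrixP => i j; rewrite !mxE lk //= ltn_addr.
Qed.

End ColumnReduction.

(** * Tensors over an integral domain *)

Lemma tofrac_inj (A : idomainType) : injective (@tofrac A).
Proof. by move=> f g /eqP; rewrite tofrac_eq => /eqP. Qed.

Section TensorAlgebra.
Variables (d : nat) (A : idomainType).
Implicit Types n m : 'I_d -> nat.

(** Distributivity holds in the fraction field and descends along its embedding. *)
Lemma prod_sum_dffun (T : 'I_d -> finType) (F : forall i, T i -> A) :
  \prod_(i < d) \sum_(j : T i) F i j =
  \sum_(f : {dffun forall i, T i}) \prod_(i < d) F i (f i).
Proof.
apply: tofrac_inj; rewrite rmorph_prod rmorph_sum.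
under eq_bigr do rewrite rmorph_sum.
rewrite (@bigA_distr_dffun d {fraction A} T (fun i j => tofrac (F i j))).
by apply: eq_bigr => f _; rewrite rmorph_prod.
Qed.

Lemma tensor_mul_comp n1 n2 n3 (g : forall i, 'M[A]_(n1 i, n2 i))
    (h : forall i, 'M[A]_(n2 i, n3 i)) (x : tensor A n1) :
  tensor_mul h (tensor_mul g x) = tensor_mul (fun i => g i *m h i) x.
Proof.
apply/ffunP => J; rewrite !ffunE.
under eq_bigr do rewrite ffunE mulr_suml.
rewrite exchange_big; apply: eq_bigr => I _.
under [in RHS]eq_bigr do rewrite mxE.
rewrite prod_sum_dffun mulr_sumr; apply: eq_bigr => L _.
by rewrite -mulrA big_split.
Qed.

Lemma tensor_mulD n m (g : forall i, 'M[A]_(n i, m i)) (x y : tensor A n) :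
  tensor_mul g (x + y) = tensor_mul g x + tensor_mul g y.
Proof.
apply/ffunP => J; rewrite !ffunE -big_split; apply: eq_bigr => I _.
by rewrite ffunE mulrDl.
Qed.

Lemma eq_tensor_mul n m (g h : forall i, 'M[A]_(n i, m i)) (x : tensor A n) :
  (forall i, g i = h i) -> tensor_mul g x = tensor_mul h x.
Proof.
move=> gh; apply/ffunP => J; rewrite !ffunE; apply: eq_bigr => I _.
by congr (_ * _); apply: eq_bigr => i _; rewrite gh.
Qed.

Definition tdvd n (a : A) (x : tensor A n) := forall J, exists y, x J = a * y.

Lemma tdvdD n a (x y : tensor A n) : tdvd a x -> tdvd a y -> tdvd a (x + y).
Proof.
move=> dx dy J; have [[x' xE] [y' yE]] := (dx J, dy J).
by exists (x' + y'); rewrite ffunE xE yE mulrDr.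
Qed.

Lemma tdvd_mul n m a (g : forall i, 'M[A]_(n i, m i)) (x : tensor A n) :
  tdvd a x -> tdvd a (tensor_mul g x).
Proof.
move=> /choice[y yP] J.
exists (\sum_I y I * \prod_(i < d) g i (I i) (J i)).
by rewrite ffunE mulr_sumr; apply: eq_bigr => I _; rewrite yP mulrA.
Qed.

End TensorAlgebra.

Lemma tensor_mul_map d (A B : comNzRingType) (f : {rmorphism A -> B})
    (n m : 'I_d -> nat) (g : forall i, 'M[A]_(n i, m i)) (x : tensor A n) :
  tensor_mul (fun i => map_mx f (g i)) [ffun I => f (x I)] =
  [ffun J => f (tensor_mul g x J)].
Proof.
apply/ffunP => J; rewrite !ffunE rmorph_sum; apply: eq_bigr => I _.
rewrite ffunE rmorphM rmorph_prod; congr (_ * _).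
by apply: eq_bigr => i _; rewrite mxE.
Qed.

(** * The quotients that define the stable rank *)

Section StableQuotients.
Variables (K : fieldType) (d : nat) (R : realType) (alpha : 'I_d -> R).
Hypothesis alpha_gt0 : forall i, 0 < alpha i.
Implicit Types n m : 'I_d -> nat.

Definition ptensor n (u : tensor K n) : tensor (pseries K) n :=
  [ffun I => psC (u I)].

Definition det_weight n (g : forall i, 'M[pseries K]_(n i)) : R :=
  \sum_(i < d) alpha i * (psord (\det (g i)))%:R.

(** The exponent [s] is allowed to be smaller than the valuation of [g . u]. This
    does not change the infimum, it covers the tensor 0, whose valuation is
    infinite, and it makes the description of direct sums an equality of sets. *)
Definition stable_quotients n (u : tensor K n) : set R :=
  [set q | exists g : forall i, 'M[pseries K]_(n i), exists s : nat,
     [/\ forall i, \det (g i) != 0, (0 < s)%N,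
         tdvd (psX K ^+ s) (tensor_mul g (ptensor u)) &
         q = det_weight g / s%:R]]%classic.

Lemma det_weight_ge0 n (g : forall i, 'M[pseries K]_(n i)) : 0 <= det_weight g.
Proof. by apply: sumr_ge0 => i _; rewrite mulr_ge0 // ltW. Qed.

Lemma stable_quotients_ge0 n (u : tensor K n) : lbound (stable_quotients u) 0.
Proof. by move=> _ [g [s [_ _ _ ->]]]; rewrite divr_ge0 ?det_weight_ge0. Qed.

(** The scalar matrices [t] multiply every tensor by [t ^ d]. *)
Lemma stable_quotients_neq0 n (u : tensor K n) : (0 < d)%N ->
  (stable_quotients u !=set0)%classic.
Proof.
move=> d0; eexists; exists (fun i => (psX K)%:M), 1%N; split=> //.
  by move=> i; rewrite det_scalar expf_neq0 // psX_neq0.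
rewrite expr1 => J; rewrite ffunE.
have dv I : exists y, \prod_(i < d) (psX K)%:M (I i) (J i) = psX K * y.
  rewrite (bigD1 (Ordinal d0)) //= mxE.
  case: eqP => _; last by exists 0; rewrite mulr0n mul0r mulr0.
  by rewrite mulr1n; eexists.
have [y yP] := choice dv.
exists (\sum_I ptensor u I * y I); rewrite mulr_sumr.
by apply: eq_bigr => I _; rewrite yP mulrCA.
Qed.

Lemma det_weight_subst k n (g : forall i, 'M[pseries K]_(n i)) :
  (forall i, \det (g i) != 0) ->
  det_weight (fun i => map_mx (pssubst k) (g i)) = k.+1%:R * det_weight g.
Proof.
move=> g0; rewrite mulr_sumr; apply: eq_bigr => i _.
by rewrite det_map_mx psord_subst // natrM mulrCA.
Qed.

Lemma tdvd_subst k s n (g : forall i, 'M[pseries K]_(n i)) (u : tensor K n) :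
  tdvd (psX K ^+ s) (tensor_mul g (ptensor u)) ->
  tdvd (psX K ^+ (k.+1 * s))
    (tensor_mul (fun i => map_mx (pssubst k) (g i)) (ptensor u)).
Proof.
move=> dv J; have [y yE] := dv J; exists (pssubst k y).
have -> : ptensor u = [ffun I => pssubst k (ptensor u I)].
  by apply/ffunP => I; rewrite !ffunE pssubst_psC.
by rewrite tensor_mul_map ffunE yE rmorphM rmorphXn /= pssubst_psX -exprM.
Qed.

(** A direct sum decomposition of the factors is given by a basis of each: the rows
    of [P i], of which the first [n i] span the first summand. The basis is not
    assumed to be the standard one, because the coordinates that come with a
    product of vector spaces need not be the concatenated ones. *)
Section DirectSum.
Variables (n m : 'I_d -> nat) (P : forall i, 'M[K]_(n i + m i)).
Hypothesis P_unit : forall i, P i \in unitmx.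
Variables (v : tensor K n) (w : tensor K m).

Let u : tensor K (fun i => (n i + m i)%N) :=
  tensor_mul (fun i => usubmx (P i)) v + tensor_mul (fun i => dsubmx (P i)) w.
Let PS i : 'M[pseries K]_(n i + m i) := map_mx (@psC K) (P i).

(** The rows of [PS i *m g i] are the images under [g i] of the adapted basis; the
    upper ones act on [v], the lower ones on [w]. *)
Let tensor_mul_dsum (g : forall i, 'M[pseries K]_(n i + m i)) :
  tensor_mul g (ptensor u) =
    tensor_mul (fun i => usubmx (PS i *m g i)) (ptensor v) +
    tensor_mul (fun i => dsubmx (PS i *m g i)) (ptensor w).
Proof.
have -> : ptensor u =
    tensor_mul (fun i => map_mx (@psC K) (usubmx (P i))) (ptensor v) +
    tensor_mul (fun i => map_mx (@psC K) (dsubmx (P i))) (ptensor w).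
  by rewrite !tensor_mul_map; apply/ffunP => J; rewrite !ffunE rmorphD.
rewrite tensor_mulD !tensor_mul_comp; congr (_ + _); apply: eq_tensor_mul => i.
  by rewrite -mul_usub_mx map_usubmx.
by rewrite -mul_dsub_mx map_dsubmx.
Qed.

Let detPS i : \det (PS i) \is a GRing.unit.
Proof. by rewrite det_map_mx psC_unit // -unitfE -unitmxE. Qed.

(** Equalise the valuations by the substitutions [t := t ^ r] and [t := t ^ s], and
    put the two tuples together as diagonal blocks in the adapted bases. *)
Lemma stable_quotients_dsum_add q1 q2 :
  stable_quotients v q1 -> stable_quotients w q2 -> stable_quotients u (q1 + q2).
Proof.
move=> [g [s [g0 s0 gs ->]]] [h [r [h0 r0 hr ->]]].
pose a i := map_mx (pssubst r.-1) (g i).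
pose b i := map_mx (pssubst s.-1) (h i).
have a0 i : \det (a i) != 0.
  by rewrite det_map_mx; apply: has_order_neq0 (has_order_subst _ (psordP (g0 i))).
have b0 i : \det (b i) != 0.
  by rewrite det_map_mx; apply: has_order_neq0 (has_order_subst _ (psordP (h0 i))).
pose G i := invmx (PS i) *m block_mx (a i) 0 0 (b i).
have PG i : PS i *m G i = block_mx (a i) 0 0 (b i).
  by rewrite mulKVmx // unitmxE.
have detG i : \det (G i) = (\det (PS i))^-1 * (\det (a i) * \det (b i)).
  by rewrite det_mulmx det_inv det_ublock.
exists G, (r * s)%N; split.
- by move=> i; rewrite detG !mulf_neq0 ?invr_eq0 // ps_unit_neq0.
- by rewrite muln_gt0 r0.
- rewrite tensor_mul_dsum; apply: tdvdD.
    rewrite (@eq_tensor_mul _ _ _ _ _ (fun i => a i *m row_mx 1%:M 0)); last first.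
      by move=> i; rewrite PG /block_mx col_mxKu mul_mx_row mulmx1 mulmx0.
    rewrite -tensor_mul_comp; apply: tdvd_mul.
    by rewrite -{1}(prednK r0); apply: tdvd_subst.
  rewrite (@eq_tensor_mul _ _ _ _ _ (fun i => b i *m row_mx 0 1%:M)); last first.
    by move=> i; rewrite PG /block_mx col_mxKd mul_mx_row mulmx1 mulmx0.
  rewrite -tensor_mul_comp; apply: tdvd_mul.
  by rewrite mulnC -{1}(prednK s0); apply: tdvd_subst.
have -> : det_weight G = r%:R * det_weight g + s%:R * det_weight h.
  rewrite -{1}(prednK r0) -{1}(prednK s0) -!det_weight_subst // -big_split.
  apply: eq_bigr => i _ /=; rewrite -mulrDr -natrD; congr (_ * _%:R).
  rewrite detG psordM ?psordM ?mulf_neq0 ?invr_eq0 // ?ps_unit_neq0 //.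
  by rewrite psord_unit ?unitrV.
have rn0 : r%:R != 0 :> R by rewrite pnatr_eq0 -lt0n.
have sn0 : s%:R != 0 :> R by rewrite pnatr_eq0 -lt0n.
rewrite natrM invfM mulrDl mulrACA divff // mul1r; congr (_ + _).
by rewrite [r%:R^-1 * _]mulrC mulrACA divff // mul1r.
Qed.

(** Make the factor [i0] block lower triangular and the others, among which [i1],
    block upper triangular. The zero block at [i1] removes [w] from the component
    of the image in the tensor product of the first summands, and the zero block at
    [i0] removes [v] from the component in that of the second summands. *)
Lemma stable_quotients_dsum_split q : (2 <= d)%N -> stable_quotients u q ->
  exists q1 q2, [/\ stable_quotients v q1, stable_quotients w q2 & q = q1 + q2].
Proof.
move=> d2 [g [s [g0 s0 gs ->]]].
pose i0 : 'I_d := Ordinal (ltnW d2); pose i1 : 'I_d := Ordinal d2.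
have red i : exists k : 'M[pseries K]_(n i + m i), [/\ k \in unitmx,
    i = i0 -> ursubmx (PS i *m g i *m k) = 0 &
    i <> i0 -> dlsubmx (PS i *m g i *m k) = 0].
  have [->|/eqP ni] := eqVneq i i0.
    have [k ku [a [c [b e]]]] :=
      block_lower_reduction (@ps_dvd_total K) (PS i0 *m g i0).
    by exists k; split=> // _; rewrite e block_mxKur.
  have [k ku [a [c [b e]]]] :=
    block_upper_reduction (@ps_dvd_total K) (PS i *m g i).
  by exists k; split=> // _; rewrite e block_mxKdl.
pose k i := sval (cid (red i)).
pose Q i := PS i *m g i *m k i.
have ku i : k i \in unitmx by have [] := svalP (cid (red i)).
have Q0 : ursubmx (Q i0) = 0 by have [_ + _] := svalP (cid (red i0)); apply.
have Q1 i : i <> i0 -> dlsubmx (Q i) = 0.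
  by have [_ _] := svalP (cid (red i)).
pose a i := ulsubmx (Q i); pose b i := drsubmx (Q i).
have detQ i : \det (Q i) = \det (a i) * \det (b i).
  rewrite -[Q i in LHS]submxK; have [e|/eqP ni] := eqVneq i i0.
    by rewrite /a /b e Q0 det_lblock.
  by rewrite Q1 // det_ublock.
have detQE i : \det (Q i) = \det (PS i) * \det (k i) * \det (g i).
  by rewrite !det_mulmx mulrAC.
have ukPS i : \det (PS i) * \det (k i) \is a GRing.unit.
  by rewrite unitrM detPS -unitmxE ku.
have detQ0 i : \det (Q i) != 0.
  by rewrite detQE mulf_neq0 // ps_unit_neq0.
have a0 i : \det (a i) != 0.
  by apply: contraNneq (detQ0 i) => e; rewrite detQ e mul0r.
have b0 i : \det (b i) != 0.
  by apply: contraNneq (detQ0 i) => e; rewrite detQ e mulr0.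
have := tdvd_mul k gs.
rewrite tensor_mul_comp tensor_mul_dsum.
rewrite (@eq_tensor_mul _ _ _ _ _ (fun i => usubmx (Q i)) (ptensor v)); last first.
  by move=> i; rewrite mulmxA.
rewrite (@eq_tensor_mul _ _ _ _ _ (fun i => dsubmx (Q i)) (ptensor w)); last first.
  by move=> i; rewrite mulmxA.
set x := (X in tdvd _ X) => dx.
exists (det_weight a / s%:R), (det_weight b / s%:R); split.
- exists a, s; split=> // J.
  (* the coordinate [J] of [a . v] is that of the image at the left columns *)
  have [y yE] := dx [ffun i => lshift (m i) (J i)]; exists y; rewrite -yE !ffunE.
  rewrite [X in _ + X]big1 ?addr0 => [|I _].
    apply: eq_bigr => I _; congr (_ * _); apply: eq_bigr => i _.
    by rewrite !ffunE !mxE.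
  rewrite (bigD1 i1) //= !ffunE.
  have -> : dsubmx (Q i1) (I i1) (lshift (m i1) (J i1)) =
      dlsubmx (Q i1) (I i1) (J i1).
    by rewrite [RHS]mxE.
  by rewrite Q1 // mxE mul0r mulr0.
- exists b, s; split=> // J.
  (* the coordinate [J] of [b . w] is that of the image at the right columns *)
  have [y yE] := dx [ffun i => rshift (n i) (J i)]; exists y; rewrite -yE !ffunE.
  rewrite [X in X + _]big1 ?add0r => [|I _].
    apply: eq_bigr => I _; congr (_ * _); apply: eq_bigr => i _.
    by rewrite !ffunE !mxE.
  rewrite (bigD1 i0) //= !ffunE.
  have -> : usubmx (Q i0) (I i0) (rshift (n i0) (J i0)) =
      ursubmx (Q i0) (I i0) (J i0).
    by rewrite [RHS]mxE.
  by rewrite Q0 mxE mul0r mulr0.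
rewrite -mulrDl -big_split; congr (_ / _); apply: eq_bigr => i _ /=.
rewrite -mulrDr -natrD; congr (_ * _%:R).
rewrite -psordM // -detQ detQE (psordM (ps_unit_neq0 (ukPS i)) (g0 i)).
by rewrite (psord_unit (ukPS i)).
Qed.

End DirectSum.
End StableQuotients.

(** * Valuations of power series vectors *)

Section Valuation.
Variables (K : fieldType) (R : realType).
Local Notation t := (psX K).

Lemma valt_ge (I : finType) (x : I -> pseries K) (n : nat) :
  (forall i, exists y, x i = t ^+ n * y) ->
  (n%:R%:E <= valt R (fun i => tofrac (x i)))%E.
Proof.
move=> dv; apply: ereal_sup_ubound; exists n%:Z; last by rewrite pmulrn.
by move=> i; have [y ->] := dv i; exists y; rewrite rmorphM rmorphXn.
Qed.

Lemma valt_eq (I : finType) (x : I -> pseries K) (n : nat) i0 :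
  (forall i, exists y, x i = t ^+ n * y) -> pcoef (x i0) n != 0 ->
  valt R (fun i => tofrac (x i)) = n%:R%:E.
Proof.
move=> dv xn; apply/le_anti; rewrite valt_ge // andbT.
apply: ge_ereal_sup => _ [[k|k] /(_ i0)[y yE] <-]; last first.
  by rewrite lee_fin NegzE mulrNz (le_trans _ (ler0n _ _)) // oppr_le0 -pmulrn ler0n.
rewrite lee_fin -pmulrn ler_nat leqNgt; apply: contra xn => nk.
move: yE; rewrite -[tvar K ^ k]/(tofrac t ^+ k) -rmorphXn -rmorphM.
by move/tofrac_inj => ->; rewrite pcoefXnM nk.
Qed.

(** The entries being integral, the supremum in [valt] is a natural number, and it is
    attained, unless all the entries vanish. *)
Lemma valtP (I : finType) (x : I -> pseries K) :
  (valt R (fun i => tofrac (x i)) = +oo%E /\ forall i, x i = 0) \/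
  (exists n : nat, valt R (fun i => tofrac (x i)) = n%:R%:E /\
     forall i, exists y, x i = t ^+ n * y).
Proof.
have [x0|/existsNP[i /eqP/ps_order[n0 xn0 _]]] := pselect (forall i, x i = 0).
  left; split=> //; apply/eqyP => r r0.
  apply: le_trans (@valt_ge _ _ (Num.truncn r).+1 _) => [|i].
    by rewrite lee_fin ltW // truncnS_gt.
  by exists 0; rewrite x0 mulr0.
have ex : exists n, [exists i, pcoef (x i) n != 0].
  by exists n0; apply/existsP; exists i.
right; case: (ex_minnP ex) => n /existsP[j xjn] minn; exists n.
have dv k : exists y, x k = t ^+ n * y.
  eexists; apply: psX_factor => l ln; apply/eqP; apply: contraTT ln => xkl.
  by rewrite -leqNgt; apply: minn; apply/existsP; exists k.
by split=> //; apply: valt_eq xjn.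
Qed.

Lemma valt_scalarE (f : pseries K) : f != 0 ->
  valt_scalar R (tofrac f) = (psord f)%:R%:E.
Proof.
move=> /psordP fo; apply: (@valt_eq _ (fun=> f) _ tt) => [_|].
  by case: fo => u _ fE; exists u.
by have [] := has_order_coef fo.
Qed.

End Valuation.

(** * The stable rank as an infimum of real numbers *)

Section StableRank.
Variables (K : fieldType) (d : nat) (R : realType) (alpha : 'I_d -> R).
Hypotheses (d_gt0 : (0 < d)%N) (alpha_gt0 : forall i, 0 < alpha i).
Variables (U : 'I_d -> vectType K) (u : tprod U).

Lemma valt_act (g : endo_tuple U) :
  valt R (act g u) = valt R (fun J => tofrac (tensor_mul g (ptensor u) J)).
Proof.
congr valt; apply/funext => J; rewrite /act.
have -> : tensor_laurent u = [ffun I => tofrac (ptensor u I)].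
  by apply/ffunP => I; rewrite !ffunE.
by rewrite tensor_mul_map ffunE.
Qed.

Lemma GLpseriesE (g : endo_tuple U) : GLpseries g <-> forall i, \det (g i) != 0.
Proof.
by split=> gP i; have := gP i; rewrite unitmxE det_map_mx unitfE tofrac_eq0.
Qed.

Lemma muE (g : endo_tuple U) : (forall i, \det (g i) != 0) ->
  mu alpha g u = ((det_weight alpha g)%:E / valt R (act g u))%E.
Proof.
move=> g0; congr (_ * _)%E; rewrite /det_weight -sumEFin.
by apply: eq_bigr => i _; rewrite det_map_mx valt_scalarE.
Qed.

(** Each [mu g u] is a quotient when the valuation of [g . u] is finite, and bounds
    from below the quotients of [g] in any case. When [g . u = 0], [mu g u] is 0,
    which is approached by the quotients [D / s] with [s] arbitrarily large. *)
Lemma Gstable_rankE : Gstable_rank alpha u = (inf (stable_quotients alpha u))%:E.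
Proof.
set Q := stable_quotients alpha u.
have Qlb : has_lbound Q by exists 0; apply: stable_quotients_ge0.
have Q0 : (Q !=set0)%classic by apply: stable_quotients_neq0.
rewrite -ereal_inf_EFin //; apply/le_anti/andP; split.
  apply: le_ereal_inf_tmp => _ [_ [g [s [g0 s0 gs ->]]] <-].
  have sR : 0 < s%:R :> R by rewrite ltr0n.
  have vs : (s%:R%:E <= valt R (act g u))%E by rewrite valt_act; apply: valt_ge.
  apply: (@le_trans _ _ (mu alpha g u)).
    apply: ereal_inf_lbound; exists g => //; split; first exact/GLpseriesE.
    by apply: lt_le_trans vs; rewrite lte_fin.
  rewrite muE //; move: vs; rewrite valt_act.
  have [[-> _] _|[n [-> _]]] := valtP R (tensor_mul g (ptensor u)).
    by rewrite invey mule0 lee_fin divr_ge0 ?det_weight_ge0.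
  rewrite lee_fin => sn; have nR := lt_le_trans sR sn.
  rewrite inver gt_eqF // lee_fin ler_wpM2l ?det_weight_ge0 //.
  by rewrite lef_pV2.
apply: le_ereal_inf_tmp => _ [g [/GLpseriesE g0 +] <-].
rewrite muE // valt_act.
have [[-> x0] _|[n [-> dv]]] := valtP R (tensor_mul g (ptensor u)); last first.
  rewrite lte_fin => nR; apply: ereal_inf_lbound.
  rewrite inver gt_eqF //; exists (det_weight alpha g / n%:R) => //.
  by exists g, n; split=> //; rewrite -(ltr0n R).
rewrite invey mule0 ereal_inf_EFin // lee_fin leNgt; apply/negP => c0.
set c := inf Q in c0; set D := det_weight alpha g.
pose s := (Num.truncn (D / c)).+1.
have sc : D / c < s%:R by rewrite truncnS_gt.
have : c <= D / s%:R.
  apply: ge_inf => //; exists g, s; split=> // J.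
  by exists 0; rewrite x0 mulr0.
by rewrite ler_pdivlMr ?ltr0Sn // leNgt mulrC -ltr_pdivrMr // sc.
Qed.

End StableRank.

(** * The vertical direct sum *)

(** The two inclusions are jointly injective, so that the images of the bases of
    [V i] and [W i] form a basis of the product. *)
Lemma incl_matrix_unit (K : fieldType) d (V W : 'I_d -> vectType K) i :
  (col_mx (f2mx (incl1 V W i)) (f2mx (incl2 V W i))
     : 'M_(dim (V i) + dim (W i))) \in unitmx.
Proof.
rewrite -row_free_unit -kermx_eq0; apply/rowV0P => x /sub_kermxP.
rewrite -[x]hsubmxK mul_row_col => e.
pose a : V i := r2v (lsubmx x); pose b : W i := r2v (rsubmx x).
have : incl1 V W i a + incl2 V W i b = 0.
  apply: v2r_inj; rewrite linearD linear0 unlock /= !r2vK.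
  exact: e.
rewrite incl1E incl2E => -[]; rewrite addr0 add0r => a0 b0.
have := congr1 v2r a0; have := congr1 v2r b0.
by rewrite !r2vK !linear0 => -> ->; rewrite row_mx0.
Qed.

Lemma vdsumE (K : fieldType) d (V W : 'I_d -> vectType K) (v : tprod V) (w : tprod W) :
  vdsum v w =
    let P i : 'M_(dim (V i) + dim (W i)) :=
      col_mx (f2mx (incl1 V W i)) (f2mx (incl2 V W i)) in
    tensor_mul (fun i => usubmx (P i)) v + tensor_mul (fun i => dsubmx (P i)) w.
Proof.
by congr (_ + _); apply: eq_tensor_mul => i; rewrite ?col_mxKu ?col_mxKd.
Qed.

Theorem proposition3p8 (K : fieldType) (K_perfect : perfect_field K)
    (d : nat) (d_ge2 : (2 <= d)%N) (V W : 'I_d -> vectType K)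
    (R : realType) (alpha : 'I_d -> R) (alpha_gt0 : forall i, (0 < alpha i)%R)
    (v : tprod V) (w : tprod W) :
  (Gstable_rank alpha (vdsum v w) = Gstable_rank alpha v + Gstable_rank alpha w)%E.
Proof.
have d0 := ltnW d_ge2.
have has_inf_Q n (u : tensor K n) : has_inf (stable_quotients alpha u).
  split; first exact: stable_quotients_neq0.
  by exists 0; apply: stable_quotients_ge0.
rewrite !Gstable_rankE // -EFinD -inf_sumE //; congr (inf _)%:E.
rewrite vdsumE; apply/seteqP; split=> [q|_ [q1 Q1 [q2 Q2 <-]]].
  move=> /(stable_quotients_dsum_split (incl_matrix_unit V W) d_ge2).
  by move=> [q1 [q2 [Q1 Q2 ->]]]; exists q1 => //; exists q2.
exact: (stable_quotients_dsum_add (incl_matrix_unit V W)).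
Qed.
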